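(* For the decentralized caching problem with $N$ files and local cache size $M$ files per user, if $M>0$ then $$\mathcal{R}=\left\{\{R_K\}_{K\in\mathbb{N}}\ :\ R_K\ge \mathbb{E}_{\boldsymbol{d}}\left[\frac{N-M}{M}\left(1-\left(\frac{N-M}{N}\right)^{N_{\mathrm{e}}(\boldsymbol{d})}\right)\right]\ \text{for all }K\in\mathbb{N}\right\},$$ where for each $K$ the demand $\boldsymbol{d}$ is uniformly distributed on $\{1,\dots,N\}^K$; and if $M=0$ then $\mathcal{R}=\{\{R_K\}_{K\in\mathbb{N}}: R_K\ge\mathbb{E}_{\boldsymbol{d}}[N_{\mathrm{e}}(\boldsymbol{d})]\text{ for all }K\}$.
   Context: Setting: a server holds $N$ files of $F$ bits each, all bits i.i.d. Bernoulli$(1/2)$; bit $j$ of file $i$ is $B_{i,j}$. Each user has a cache of $MF$ bits, $M\in[0,N]$. A prefetching distribution $P_{\mathcal{M}}$ is a probability distribution on sets of at most $MF$ bit indices $(i,j)$; when $K$ users make requests, their cache index sets $\mathcal{M}_1,\dots,\mathcal{M}_K$ are drawn i.i.d. from $P_{\mathcal{M}}$ (user $k$ stores the bits indexed by $\mathcal{M}_k$, uncoded). A decentralized caching scheme $P_{\mathcal{M};F}$ specifies such a distribution for every file size $F$ (independently of $K$). For a deterministic prefetching $\boldsymbol{\mathcal{M}}=(\mathcal{M}_1,\dots,\mathcal{M}_K)$ and demand $\boldsymbol{d}\in\{1,\dots,N\}^K$, a rate $R$ is $\epsilon$-achievable if there are an encoder $X=\psi(W_1,\dots,W_N)\in\{0,1\}^{RF}$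 and decoders for each user $k$ (using $X$ and its cached bits) each recovering $W_{d_k}$ with error probability at most $\epsilon$. Given $P_{\mathcal{M}}$ and $\boldsymbol{d}$ with $K$ users, $R$ is $\epsilon$-achievable if for every realization $\boldsymbol{\mathcal{M}}$ there is $\epsilon_{\boldsymbol{\mathcal{M}}}$ such that $R$ is $\epsilon_{\boldsymbol{\mathcal{M}}}$-achievable given $\boldsymbol{\mathcal{M}},\boldsymbol{d}$ and $\mathbb{E}[\epsilon_{\boldsymbol{\mathcal{M}}}]\le\epsilon$; $R^*_{\epsilon,K}(\boldsymbol{d},P_{\mathcal{M}})$ is the minimum such rate. Define $R^*_K(P_{\mathcal{M};F})=\sup_{\epsilon>0}\limsup_{F'\to\infty}\mathbb{E}_{\boldsymbol{d}}[R^*_{\epsilon,K}(\boldsymbol{d},P_{\mathcal{M};F}(F=F'))]$ with $\boldsymbol{d}$ uniform on $\{1,\dots,N\}^K$, and $\mathcal{R}=\bigcup_{P_{\mathcal{M};F}}\{\{R_K\}_{K\in\mathbb{N}}: R_K\ge R^*_K(P_{\mathcal{M};F})\ \forall K\}$. $N_{\mathrm{e}}(\boldsymbol{d})$ is the number of distinct entries of $\boldsymbol{d}$. *)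

(* Defs.v *)
From HB Require Import structures.
From mathcomp Require Import all_boot all_order all_algebra.
From mathcomp Require Import all_classical all_reals all_analysis.
Set Implicit Arguments. Unset Strict Implicit. Unset Printing Implicit Defensive.
Import Order.TTheory GRing.Theory Num.Theory.
Local Open Scope classical_set_scope.
Local Open Scope ring_scope.

Section Caching.
Variable R : realType.

(* bit indices (i, j): bit j of file i *)
Definition bidx (N F : nat) : finType := ('I_N * 'I_F)%type.
Definition library (N F : nat) := {ffun bidx N F -> bool}.
Definition cacheset (N F : nat) := {set bidx N F}.

Definition file N F (W : library N F) (i : 'I_N) : {ffun 'I_F -> bool} :=
  [ffun j => W (i, j)].

Definition cache_view N F (S : cacheset N F) (W : library N F)
  : {ffun bidx N F -> option bool} :=
  [ffun b => if b \in S then Some (W b) else None].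

Definition prefetching (N F : nat) (M : R) (P : {ffun cacheset N F -> R}) : Prop :=
  (forall S, 0 <= P S) /\ (\sum_S P S = 1) /\
  (forall S, P S != 0 -> (#|S|%:R <= M * F%:R)).

Definition dec_scheme (N : nat) (M : R) (PF : forall F : nat, {ffun cacheset N F -> R})
  : Prop := forall F, prefetching M (PF F).

(* error probability (bits i.i.d. Bernoulli(1/2), i.e. library uniform) of
   user k in recovering file (d k) *)
Definition err_prob N F K L
    (enc : library N F -> {ffun 'I_L -> bool})
    (dec : 'I_K -> {ffun 'I_L -> bool} -> {ffun bidx N F -> option bool} ->
           {ffun 'I_F -> bool})
    (Ms : 'I_K -> cacheset N F) (d : 'I_K -> 'I_N) (k : 'I_K) : R :=
  #|[set W : library N F | dec k (enc W) (cache_view (Ms k) W) != file W (d k)]|%:R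
  / #|{: library N F}|%:R.

Definition achievable_det N F K (Rt eps : R)
    (Ms : 'I_K -> cacheset N F) (d : 'I_K -> 'I_N) : Prop :=
  exists (L : nat) (enc : library N F -> {ffun 'I_L -> bool})
         (dec : 'I_K -> {ffun 'I_L -> bool} -> {ffun bidx N F -> option bool} ->
                {ffun 'I_F -> bool}),
    L%:R <= Rt * F%:R /\ forall k, err_prob enc dec Ms d k <= eps.

Definition achievable N F K (P : {ffun cacheset N F -> R}) (Rt eps : R)
    (d : 'I_K -> 'I_N) : Prop :=
  exists epsM : {ffun 'I_K -> cacheset N F} -> R,
    (forall Ms, achievable_det Rt (epsM Ms) Ms d) /\
    \sum_(Ms : {ffun 'I_K -> cacheset N F}) (\prod_k P (Ms k)) * epsM Ms <= eps.

Definition Rstar_eps N F K (P : {ffun cacheset N F -> R}) (eps : R)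
    (d : 'I_K -> 'I_N) : R :=
  inf [set Rt : R | achievable P Rt eps d].

Definition Ed N K (f : {ffun 'I_K -> 'I_N} -> R) : R :=
  (\sum_(d : {ffun 'I_K -> 'I_N}) f d) / (N ^ K)%:R.

Definition Rstar_K N (PF : forall F : nat, {ffun cacheset N F -> R}) (K : nat)
  : \bar R :=
  ereal_sup [set limn_esup (fun F => (Ed (fun d : {ffun 'I_K -> 'I_N} =>
                 Rstar_eps (PF F) eps d))%:E) | eps in [set e : R | 0 < e]].

Definition region N (M : R) : set (nat -> R) :=
  [set Rs | exists PF : forall F : nat, {ffun cacheset N F -> R},
            dec_scheme M PF /\ forall K, Rstar_K PF K <= (Rs K)%:E]%E.

Definition Ne N K (d : {ffun 'I_K -> 'I_N}) : nat := #|[set d k | k : 'I_K]|.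

End Caching.

(* Main.v *)
(* Both bounds are about the function g(n) = sum_(l = 1..n) q^l with q = 1 - M/N,
   which is the closed form of the statement when M > 0 and n when M = 0.

   Converse. Call a user a leader if no earlier user asks for the same file. Given
   all bits except those of each leader's file that neither it nor an earlier
   leader caches, the transmission determines the leaders' files one after the
   other; hence its length is at least the number of these missing bits, minus one
   bit if all users succeed with probability at least 1/2. A bit avoided by one
   random cache with probability x is missing for the l-th leader with probability
   x^l. Averaging over the cyclic shifts of the demand makes the requested file
   uniform, and convexity of x^l gives the bound E[g(Ne d)].

   Achievability. Caches are uniform sets of floor(MF) bits. Cache memberships of
   two distinct bits are negatively correlated, so by Chebyshev the number of bits
   of a file cached by exactly the users of S is close to F p^|S| (1-p)^(K-|S|).
   For each set A of users containing a leader, send the xor over x in A of the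
   block of the file of x cached exactly by A minus x. The xors for the sets A
   without leader are linear combinations of these, so every user can decode. *)
Require Import Defs.
From HB Require Import structures.
From mathcomp Require Import all_boot all_order all_algebra.
From mathcomp Require Import all_classical all_reals all_analysis.
From mathcomp Require Import ring lra zify.
Set Implicit Arguments. Unset Strict Implicit. Unset Printing Implicit Defensive.
Import Order.TTheory GRing.Theory Num.Theory.
Local Open Scope classical_set_scope.
Local Open Scope ring_scope.

(** * Redundancy of the transmissions *)

Section Redundancy.
Variables (T I : finType) (d : T -> I).
Implicit Types (w Y : {set T} -> bool) (A U : {set T}) (f g : I) (fs : seq I).

(* Reading [w] as an element of the exterior algebra over F_2 generated by
   [T], [ext f] is the product with the sum of the generators of demand [f];
   hence [ext_sq] and [extC]. *)
Definition ext f w : {set T} -> bool :=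
  fun A => \sum_(x in A | d x == f) w (A :\ x).

Lemma extC f g w : ext f (ext g w) = ext g (ext f w).
Proof.
apply/funext => A; rewrite /ext.
rewrite (exchange_big_dep (fun y => (y \in A) && (d y == g))) /=; last first.
  by move=> x y _; rewrite !inE => /andP[/andP[_ ->] ->].
apply: eq_bigr => y /andP[yA dy]; apply: eq_big => [x|x _].
  by rewrite !inE yA dy !andbT andbC [x == y]eq_sym andbA.
by rewrite !finset.setDDl finset.setUC.
Qed.

(** The terms at [(x, y)] and [(y, x)] cancel in characteristic 2; [enum_rank] serves to order each
    pair. *)
Lemma sum_sym_bool (s : T -> T -> bool) :
  (forall x, s x x = 0) -> (forall x y, s x y = s y x) ->
  \sum_x \sum_y s x y = 0.
Proof.
move=> s0 sC.
have -> : \sum_x \sum_y s x y =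
    \sum_x \sum_(y | (enum_rank x < enum_rank y)%N) s x y
    + \sum_x \sum_(y | (enum_rank y < enum_rank x)%N) s x y.
  rewrite -big_split; apply: eq_bigr => x _ /=.
  rewrite (bigID (fun y => (enum_rank x < enum_rank y)%N)) /=; congr (_ + _).
  rewrite (bigD1 x) ?ltnn //= s0 add0r; apply: eq_bigl => y.
  by rewrite -leqNgt [in RHS]ltn_neqAle andbC (inj_eq val_inj) (inj_eq enum_rank_inj).
rewrite [X in _ + X](exchange_big_dep xpredT) //=.
rewrite -[X in X + _]addr0; set a := \sum_x _; set b := \sum_x _.
suff -> : b = a by rewrite addr0; exact: addbb.
by apply: eq_bigr => x _; apply: eq_bigr => y _; rewrite sC.
Qed.

Lemma ext_sq f w : ext f (ext f w) = (fun=> 0).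
Proof.
apply/funext => A; rewrite /ext.
pose s x y : bool := if [&& x \in A, y \in A, x != y, d x == f & d y == f]
  then w (A :\ x :\ y) else 0.
rewrite -[RHS](@sum_sym_bool s); first last.
- move=> x y; rewrite /s !finset.setDDl [([set x] :|: _)%SET]finset.setUC (eq_sym x).
  by congr (if _ then _ else _); do !case: (_ \in _) => //=; do !case: (_ == _).
- by move=> x; rewrite /s eqxx !andbF.
rewrite big_mkcond /=; apply: eq_bigr => x _.
case: ifP => [/andP[xA dx]|xP]; last first.
  rewrite big1 // => y _; rewrite /s; case: ifP => // /and5P[h1 _ _ h2 _].
  by rewrite h1 h2 in xP.
rewrite big_mkcond /=; apply: eq_bigr => y _; rewrite /s xA dx !inE eq_sym /=.
by congr (if _ then _ else _); do !case: (_ \in _) => //=; do !case: (_ == _).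
Qed.

Lemma ext0 f : ext f (fun=> 0) = (fun=> 0).
Proof. by apply/funext => A; rewrite /ext big1. Qed.

Let exts Y fs := foldl (fun Z f => ext f Z) Y fs.

Lemma exts0 fs : exts (fun=> 0) fs = (fun=> 0).
Proof. by elim: fs => //= f fs IH; rewrite ext0 IH. Qed.

(** By [extC] the inner [ext g] moves outward until it meets the [g] of [fs], where [ext_sq]
    applies. *)
Lemma exts_kill g w fs : g \in fs -> exts (ext g w) fs = (fun=> 0).
Proof.
elim: fs w => //= f fs IH w; rewrite inE; case: eqP => [<- _|_ /= gfs].
  by rewrite ext_sq exts0.
by rewrite extC IH.
Qed.

Lemma exts_sum (Y : I -> {set T} -> bool) fs :
  exts (fun A => \sum_g Y g A) fs = (fun A => \sum_g exts (Y g) fs A).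
Proof.
elim: fs Y => //= f fs IH Y; rewrite -IH; congr foldl.
by apply/funext => A; rewrite /ext exchange_big.
Qed.

(* Once [ext f Y = 0] by induction, its value at [u |: A], for [u] in [U] of
   demand [f], is [Y A] plus values of [Y] at sets containing [u]. *)
Lemma exts_eq0 fs U Y : uniq fs -> exts Y fs = (fun=> 0) ->
  (forall g, g \in fs -> exists2 u, u \in U & d u = g) ->
  (forall A u, u \in U -> d u \in fs -> u \in A -> Y A = 0) ->
  forall A, Y A = 0.
Proof.
elim: fs Y => [|f fs IH] Y /= => [_ -> //|/andP[ffs ufs] Y0 rep YU A].
have E0 : forall A, ext f Y A = 0.
  apply: IH => // [g gfs|B u uU dufs uB]; first by apply: rep; rewrite inE gfs orbT.
  rewrite /ext big1 // => x /andP[xB /eqP dx].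
  apply: (YU _ u) => //; rewrite !inE ?dufs ?orbT // uB andbT.
  by apply: contraNneq ffs => ux; rewrite -dx -ux.
have [u uU du] := rep f (mem_head _ _).
have [uA|uA] := boolP (u \in A); first by apply: (YU _ u); rewrite ?du ?mem_head.
have := E0 (u |: A); rewrite /ext (bigD1 u) /= ?setU11 ?du ?eqxx //.
rewrite setU1K // big1 ?addr0 // => x /andP[_ xu].
by apply: (YU _ u); rewrite ?du ?mem_head // !inE eqxx eq_sym xu.
Qed.

(** In the exterior algebra this is the sum over [g] of the products [ext g (w g)]. *)
Definition xmit (w : I -> {set T} -> bool) A : bool :=
  \sum_(x in A) w (d x) (A :\ x).

(** Applying [ext f] for all requested [f] kills every summand [ext g (w g)]: by [exts_kill] if [g]
    is requested, and because [ext g] is an empty sum otherwise. This is the relation that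
    [exts_eq0] exploits. *)
Lemma xmit_eq0 (w : I -> {set T} -> bool) U :
  (forall x, exists2 u, u \in U & d u = d x) ->
  (forall A u, u \in U -> u \in A -> xmit w A = 0) ->
  forall A, xmit w A = 0.
Proof.
move=> rep wU.
apply: (@exts_eq0 (enum [set d x | x : T]%SET) U) => [|||A u uU _ uA].
- exact: enum_uniq.
- have -> : xmit w = fun A => \sum_g ext g (w g) A.
    apply/funext => A; rewrite /xmit /ext (partition_big d xpredT) //=.
    by apply: eq_bigr => g _; apply: eq_bigr => x /andP[_ /eqP ->].
  rewrite exts_sum; apply/funext => A; rewrite big1 // => g _.
  have [gd|gd] := boolP (g \in [set d x | x : T]%SET).
    by rewrite exts_kill ?mem_enum.
  have -> : ext g (w g) = (fun=> 0).
    apply/funext => B; rewrite /ext big1 // => x /andP[_ /eqP dx].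
    by rewrite -dx imset_f ?inE in gd.
  by rewrite exts0.
- by move=> g; rewrite mem_enum => /imsetP[x _ ->].
- exact: wU uU uA.
Qed.

End Redundancy.

(** * Coded delivery *)

Section Delivery.
Variables (N F K : nat) (Ms : 'I_K -> cacheset N F) (d : 'I_K -> 'I_N).
Variables (U : {set 'I_K}) (ell : nat -> nat).

Definition cached_by (b : bidx N F) : {set 'I_K} := [set k | b \in Ms k]%SET.

Definition block (f : 'I_N) (S : {set 'I_K}) : {set 'I_F} :=
  [set j | cached_by (f, j) == S]%SET.

(* Bits past the end of a block are [false]: blocks are zero-padded. *)
Definition block_bit (W : library N F) (t : nat) f S : bool :=
  nth false [seq W (f, j) | j <- enum (block f S)] t.

(** Nothing is sent for a set that misses [U]. The blocks xored for [A] belong to sets of [#|A|.-1]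
    users, whence the argument of [ell]. *)
Definition xmit_len (A : {set 'I_K}) : nat :=
  if [disjoint A & U] then 0%N else ell #|A|.-1.

Definition xmit_idx : finType := {A : {set 'I_K} & 'I_(xmit_len A)}.

Definition xmit_enc (W : library N F) : {ffun 'I_#|xmit_idx| -> bool} :=
  [ffun i => let z : {A : {set 'I_K} & 'I_(xmit_len A)} := enum_val i in
             xmit d (block_bit W (tagged z)) (tag z)].

Lemma card_xmit_idx : #|xmit_idx| = (\sum_A xmit_len A)%N.
Proof.
rewrite card_tagged sumnE big_map big_enum /=.
by apply: eq_bigr => A _; rewrite card_ord.
Qed.

Hypothesis ellP : forall f (S : {set 'I_K}), (#|block f S| <= ell #|S|)%N.
Hypothesis repU : forall x, exists2 u, u \in U & d u = d x.

Lemma block_bit_default W t f (S : {set 'I_K}) :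
  (ell #|S| <= t)%N -> block_bit W t f S = false.
Proof.
by move=> h; apply: nth_default; rewrite size_map -cardE (leq_trans (ellP f S)).
Qed.

(** By linearity one looks at the differences [D t] of block bits: their xors vanish for the sets
    that are sent, hence for all sets by [xmit_eq0]. *)
Lemma xmit_enc_inj k W W' : xmit_enc W = xmit_enc W' ->
  cache_view (Ms k) W = cache_view (Ms k) W' -> file W (d k) = file W' (d k).
Proof.
move=> eqX eqV.
have Wk b : b \in Ms k -> W b = W' b.
  by move=> bk; move/ffunP/(_ b): eqV; rewrite !ffunE bk => -[].
pose D t f S : bool := block_bit W t f S + block_bit W' t f S.
have D0 t : forall A, xmit d (D t) A = 0.
  apply: (xmit_eq0 repU) => A u uU uA; rewrite /xmit /D big_split /=.
  (* From position [ell #|A|.-1] on, the blocks xored for [A] contain only padding. *)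
  have [tA|tA] := ltnP t (ell #|A|.-1); last first.
    have z V : \sum_(x in A) block_bit V t (d x) (A :\ x) = 0.
      apply: big1 => x xA; rewrite block_bit_default //.
      by move: tA; rewrite (cardsD1 x A) xA.
    by rewrite !z.
  have tA' : (t < xmit_len A)%N.
    rewrite /xmit_len; case: ifPn => // /pred0P/(_ u).
    by rewrite /= uU uA.
  pose z : xmit_idx := Tagged (fun A => 'I_(xmit_len A)) (Ordinal tA').
  have := congr1 (fun g : {ffun 'I_#|xmit_idx| -> bool} => g (enum_rank z)) eqX.
  by rewrite /= !ffunE enum_rankK /= /xmit => ->; exact: addbb.
apply/ffunP => j; rewrite !ffunE; set S := cached_by (d k, j).
have [kS|kS] := boolP (k \in S); first by apply: Wk; rewrite inE in kS.
have jS : j \in enum (block (d k) S) by rewrite mem_enum inE.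
pose t := index j (enum (block (d k) S)).
(* Each user of [S] contributes a block that user [k] caches, with difference zero; only the block
   of [d k] cached exactly by [S] is left. *)
have := D0 t (k |: S); rewrite /xmit big_setU1 //= setU1K // big1 ?addr0; last first.
  move=> x xS; set A' := _ :\ x.
  have kA : k \in A' by rewrite !inE eqxx andbT; apply: contraNneq kS => ->.
  rewrite /D /block_bit (_ : map _ _ = [seq W' (d x, i) | i <- enum (block (d x) A')]).
    exact: addbb.
  apply/eq_in_map => i; rewrite mem_enum inE => /eqP iA; apply: Wk.
  by move: kA; rewrite -iA inE.
have tj : (t < size (enum (block (d k) S)))%N by rewrite index_mem.
rewrite /D /block_bit !(nth_map j) // nth_index //.
by case: (W _) (W' _) => -[].
Qed.

Lemma achievable_delivery (R : realType) (Rt : R) :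
  (\sum_A xmit_len A)%:R <= Rt * F%:R -> achievable_det Rt 0 Ms d.
Proof.
(* The decoder picks any library consistent with what user [k] sees; by [xmit_enc_inj] all of them
   agree on the requested file. *)
move=> LR; pose dec k x v := if [pick W | (xmit_enc W == x) && (cache_view (Ms k) W == v)]
  is Some W then file W (d k) else [ffun=> false].
exists #|xmit_idx|, xmit_enc, dec; split; first by rewrite card_xmit_idx.
move=> k; rewrite /err_prob eq_card0 ?mul0r // => W.
apply/negbTE/negP; rewrite !inE /= => /negP; apply; rewrite /dec.
case: pickP => [W' /andP[/eqP eX /eqP eV]|/(_ W)].
  by rewrite (xmit_enc_inj eX eV).
by rewrite !eqxx.
Qed.

End Delivery.

(** * Leaders and the cut-set bound *)

Section Leaders.
Variables (N K : nat).

Definition leaders (d : 'I_K -> 'I_N) : {set 'I_K} :=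
  [set k : 'I_K | [forall j : 'I_K, (j < k)%N ==> (d j != d k)]]%SET.

(** For [k] in [U] this is its position in increasing order, counted from 1. *)
Definition rank_in (U : {set 'I_K}) (k : 'I_K) : nat :=
  #|[set j in U | (j <= k)%N]%SET|.

Lemma leaders_rep (d : 'I_K -> 'I_N) (x : 'I_K) :
  exists u, [/\ u \in leaders d, d u = d x & (u <= x)%N].
Proof.
case: (@arg_minnP _ x [pred y | d y == d x] (@nat_of_ord K)) => //= u /eqP du um.
exists u; split=> //; last exact: um.
rewrite inE; apply/forallP => j; apply/implyP => ju; apply: contraTneq ju => dj.
by rewrite -leqNgt um // dj du.
Qed.

Lemma leaders_inj (d : 'I_K -> 'I_N) : {in leaders d &, injective d}.
Proof.
move=> x y; rewrite !inE => /forallP xl /forallP yl dxy; apply/val_inj => /=.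
case: (ltngtP x y) => // h.
  by have := implyP (yl x) h; rewrite dxy eqxx.
by have := implyP (xl y) h; rewrite dxy eqxx.
Qed.

Lemma card_leaders (d : {ffun 'I_K -> 'I_N}) : #|leaders d| = Ne d.
Proof.
rewrite -(card_in_imset (@leaders_inj d)) /Ne; apply: eq_card => f.
apply/imsetP/imsetP => -[x _ ->]; first by exists x.
by have [u [ul <- _]] := leaders_rep d x; exists u.
Qed.

(** The ranks in [U] are 1 to [#|U|]. The induction removes the largest element, which changes no
    other rank. *)
Lemma big_rank_in (V : nmodType) (h : nat -> V) (U : {set 'I_K}) :
  \sum_(k in U) h (rank_in U k) = \sum_(i < #|U|) h i.+1.
Proof.
move: {2}#|U| (erefl #|U|) => n; elim: n U => [|n IH] U Un.
  by rewrite Un big_ord0 (cards0_eq Un) big_set0.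
have [u uU] : exists u, u \in U by apply/card_gt0P; rewrite Un.
case: (@arg_maxnP _ u (mem U) (@nat_of_ord K) uU) => k0 k0U' k0max.
have k0U : k0 \in U by [].
have {}k0max k : k \in U -> (k <= k0)%N by move=> kU; exact: k0max.
have Un' : #|U :\ k0| = n by move: Un; rewrite (cardsD1 k0 U) k0U => -[].
rewrite (big_setD1 k0) //= Un big_ord_recr /= addrC; congr (_ + _).
  rewrite -Un' -IH //; apply: eq_bigr => k; rewrite !inE => /andP[kk0 kU].
  congr h; apply: eq_card => j; rewrite !inE; case: eqP => //= ->.
  apply/negbTE; rewrite k0U /= -ltnNge ltn_neqAle (k0max k kU) andbT.
  by rewrite (inj_eq val_inj).
congr h; rewrite -Un; apply: eq_card => j; rewrite !inE.
by apply: andb_idr => jU; exact: k0max.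
Qed.

End Leaders.

Section Cutset.
Variables (N F K : nat) (Ms : 'I_K -> cacheset N F) (d : 'I_K -> 'I_N).

(** Pairs of a leader and a position in its file, so that the count splits over leaders. *)
Definition fresh : {set 'I_K * 'I_F} :=
  [set z | (z.1 \in leaders d) &&
    [forall k in leaders d, (k <= z.1)%N ==> ((d z.1, z.2) \notin Ms k)]]%SET.

Definition missing : cacheset N F := [set (d z.1, z.2) | z in fresh]%SET.

Lemma card_missing : #|missing| = #|fresh|.
Proof.
apply: card_in_imset => -[x1 x2] [y1 y2].
rewrite inE => /andP[/= xl _]; rewrite inE => /andP[/= yl _] [dxy ->].
by rewrite (leaders_inj xl yl dxy).
Qed.

(* Off [missing], the file of each leader is determined by the transmission
   and by the files of the earlier leaders: outside those files, the cache of
   a leader does not meet [missing]. *)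
Lemma cutset_bound L (enc : library N F -> {ffun 'I_L -> bool})
    (dec : 'I_K -> {ffun 'I_L -> bool} -> {ffun bidx N F -> option bool} ->
           {ffun 'I_F -> bool}) :
  (#|[set W | [forall k, dec k (enc W) (cache_view (Ms k) W) == file W (d k)]]%SET|
   <= 2 ^ (L + (#|bidx N F| - #|missing|)))%N.
Proof.
set G := [set W | _]%SET.
pose off (W : library N F) : library N F :=
  [ffun b => if b \in missing then false else W b].
(* A masked library is free only outside [missing], which gives the exponent of the bound. *)
pose cod : {set {ffun 'I_L -> bool} * library N F} :=
  finset.setX [set: _]%SET [set W in pffun_on false (mem (~: missing)) predT]%SET.
have cardcod : #|cod| = (2 ^ (L + (#|bidx N F| - #|missing|)))%N.
  rewrite finset.cardsX cardsT card_ffun card_bool card_ord cardsE card_pffun_on.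
  rewrite card_bool expnD; congr (_ * _ ^ _)%N.
  by rewrite -(cardsC missing) addKn.
rewrite -cardcod -(@card_in_imset _ _ (fun W => (enc W, off W)) G); last first.
  move=> W W'; rewrite !inE => /forallP WG /forallP W'G [eX eoff].
  have eqoff b : b \notin missing -> W b = W' b.
    by move=> bm; move/ffunP/(_ b): eoff; rewrite !ffunE (negbTE bm).
  (* Induction over the users in order; a user that is not a leader takes over the file from the
     earlier leader with the same demand. *)
  have fileE : forall n (k : 'I_K), (k < n)%N -> file W (d k) = file W' (d k).
    elim=> // n IH k kn; have [u [ul du uk]] := leaders_rep d k.
    have [ltuk|] := ltnP u k; first by rewrite -du; apply: IH; exact: leq_trans ltuk kn.
    move=> /(conj uk)/andP; rewrite -eqn_leq => /eqP/val_inj uE; subst u.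
    rewrite -(eqP (WG k)) -(eqP (W'G k)) eX; congr dec.
    apply/ffunP => b; rewrite !ffunE; case: ifP => // bk; congr Some.
    have [/imsetP[[x j]]|] := boolP (b \in missing); last exact: eqoff.
    rewrite inE /= => /andP[xl /forallP xf] bE; rewrite {}bE in bk *.
    have xk : (x < k)%N.
      by rewrite ltnNge; apply/negP => kx; move: (xf k); rewrite ul kx bk.
    by have /ffunP/(_ j) := IH x (leq_trans xk kn); rewrite !ffunE.
  apply/ffunP => b; have [/imsetP[[x j] _ ->]|] := boolP (b \in missing); last exact: eqoff.
  by have /ffunP/(_ j) := fileE _ x (ltnSn _); rewrite !ffunE.
apply: subset_leq_card; apply/fintype.subsetP => _ /imsetP[W _ ->].
rewrite !inE /=; apply/pffun_onP; split => //; apply/supportP => b.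
by rewrite !inE negbK ffunE => ->.
Qed.

(* If [K * eps <= 1/2] then at least half of the libraries are decoded
   correctly by all users; otherwise the error term alone exceeds [N * F]. *)
Lemma missing_le (R : realType) (Rt eps : R) : ((0 < K)%N -> 0 <= eps) ->
  achievable_det Rt eps Ms d ->
  #|missing|%:R <= Rt * F%:R + 1 + 2 * K%:R * (N * F)%N%:R * eps.
Proof.
move=> eps0 [L [enc [dec [LR err]]]].
set G := [set W | [forall k, dec k (enc W) (cache_view (Ms k) W) == file W (d k)]]%SET.
have cardM : (#|missing| <= #|bidx N F|)%N by exact: max_card.
have cardB : #|bidx N F| = (N * F)%N by rewrite card_prod !card_ord.
have RF0 : 0 <= Rt * F%:R by rewrite (le_trans _ LR).
have NF0 : 0 <= (N * F)%N%:R :> R by [].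
have KE0 : 0 <= K%:R * eps.
  by have [/eps0 e0|] := ltnP 0 K; [rewrite mulr_ge0|case: (K) => // _; rewrite mul0r].
have [Keps|Keps] := leP (K%:R * eps) 2^-1; last first.
  have : #|missing|%:R <= (N * F)%N%:R :> R by rewrite ler_nat -cardB.
  nra.
have libE : #|{: library N F}| = (2 ^ (N * F))%N by rewrite card_ffun card_bool -cardB.
have lib0 : 0 < #|{: library N F}|%:R :> R by rewrite libE ltr0n expn_gt0.
pose E k := [set W : library N F |
  dec k (enc W) (cache_view (Ms k) W) != file W (d k)]%SET.
have cE k : #|E k|%:R <= eps * #|{: library N F}|%:R.
  rewrite -ler_pdivrMr // (le_trans _ (err k)) // /err_prob ler_pM2r ?invr_gt0 //.
  rewrite ler_nat; apply: subset_leq_card; apply/fintype.subsetP => W; rewrite inE => h.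
  by rewrite inE.
(* Union bound over the users. *)
have GE : (#|~: G| <= \sum_k #|E k|)%N.
  rewrite -sum1_card; under [X in (_ <= X)%N]eq_bigr do rewrite -sum1_card.
  rewrite (exchange_big_dep xpredT) //= big_mkcond leq_sum // => W _.
  case: ifP => //; rewrite !inE negb_forall => /existsP[k kW].
  by rewrite (bigD1 k) ?inE.
have G2 : (#|{: library N F}| <= 2 * #|G|)%N.
  have : #|~: G|%:R <= K%:R * eps * #|{: library N F}|%:R.
    apply: (@le_trans _ _ (\sum_k #|E k|)%:R); first by rewrite ler_nat.
    rewrite natr_sum (le_trans (ler_sum _ (fun k _ => cE k))) // sumr_const card_ord.
    by rewrite -mulrA mulr_natl.
  have GC : #|G|%:R + #|~: G|%:R = #|{: library N F}|%:R :> R.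
    by rewrite -natrD cardsC.
  have half : K%:R * eps * #|{: library N F}|%:R <= 2^-1 * #|{: library N F}|%:R.
    by rewrite ler_pM2r.
  by rewrite -(ler_nat R) natrM; lra.
(* The additional bit pays for the libraries, at most half of all, that some user decodes
   wrongly. *)
have : (2 ^ (N * F) <= 2 ^ (1 + (L + (N * F - #|missing|))))%N.
  rewrite -libE (leq_trans G2) // expnD expn1 leq_mul2l /= -cardB.
  exact: cutset_bound.
rewrite leq_exp2l // => ?.
have : #|missing|%:R <= L%:R + 1 :> R by rewrite natr1 ler_nat; lia.
nra.
Qed.

End Cutset.

(** * Random caches *)

(** A convex function lies above its tangent at [t]. In the induction step the gap is a nonnegative
    multiple of the square of [y - t]. *)
Lemma exprn_tangent (R : realDomainType) (y t : R) (n : nat) : 0 <= y -> 0 <= t ->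
  t ^+ n.+1 + n.+1%:R * t ^+ n * (y - t) <= y ^+ n.+1.
Proof.
move=> y0 t0; elim: n => [|n IH]; first by rewrite !expr1 expr0; lra.
have tn : 0 <= t ^+ n by rewrite exprn_ge0.
have := ler_wpM2l y0 IH; rewrite -exprS; apply: le_trans.
rewrite -subr_ge0 (_ : _ - _ = n.+1%:R * t ^+ n * (y - t) ^+ 2).
  by rewrite mulr_ge0 ?sqr_ge0 // mulr_ge0.
rewrite -[n.+2%:R]natr1 !exprS expr0 mulr1; ring.
Qed.

(** Summing the tangent inequalities at [t] leaves a nonnegative linear term, so a lower bound on
    the mean suffices. *)
Lemma exprn_jensen (R : realFieldType) (T : finType) (q : T -> R) (t : R) (n : nat) :
  (forall b, 0 <= q b) -> 0 <= t -> #|T|%:R * t <= \sum_b q b ->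
  #|T|%:R * t ^+ n <= \sum_b q b ^+ n.
Proof.
move=> q0 t0 qt; case: n => [|n].
  by under eq_bigr do rewrite expr0; rewrite sumr_const mulr1.
apply: le_trans (ler_sum _ (fun b _ => exprn_tangent n (q0 b) t0)).
rewrite big_split /= sumr_const -[X in _ <= X + _]mulr_natl lerDl -mulr_sumr mulr_ge0 //.
  by rewrite mulr_ge0 // exprn_ge0.
by rewrite sumrB sumr_const -mulr_natl subr_ge0.
Qed.

Section Expectation.
Variables (R : realType) (N F K : nat) (P : {ffun cacheset N F -> R}).

Definition expect (X : {ffun 'I_K -> cacheset N F} -> R) : R :=
  \sum_(Ms : {ffun 'I_K -> cacheset N F}) (\prod_k P (Ms k)) * X Ms.

Lemma expect_prod (g : 'I_K -> cacheset N F -> R) :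
  expect (fun Ms => \prod_k g k (Ms k)) = \prod_k \sum_S P S * g k S.
Proof.
by rewrite bigA_distr_bigA; apply: eq_bigr => Ms _; rewrite big_split.
Qed.

Hypothesis P_ge0 : forall S, 0 <= P S.
Hypothesis P_sum1 : \sum_S P S = 1.

Lemma expect_le X Y : (forall Ms, X Ms <= Y Ms) -> expect X <= expect Y.
Proof. by move=> XY; apply: ler_sum => Ms _; rewrite ler_wpM2l // prodr_ge0. Qed.

Lemma expect_sum (I : Type) (r : seq I) (Q : pred I) X :
  expect (fun Ms => \sum_(i <- r | Q i) X i Ms) = \sum_(i <- r | Q i) expect (X i).
Proof. by rewrite exchange_big /=; apply: eq_bigr => Ms _; rewrite mulr_sumr. Qed.

Lemma expectD X Y : expect (fun Ms => X Ms + Y Ms) = expect X + expect Y.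
Proof. by rewrite -big_split; apply: eq_bigr => Ms _; rewrite mulrDr. Qed.

Lemma expectZ c X : expect (fun Ms => c * X Ms) = c * expect X.
Proof. by rewrite /expect mulr_sumr; apply: eq_bigr => Ms _; rewrite mulrCA. Qed.

Lemma expect_cst c : expect (fun=> c) = c.
Proof.
rewrite /expect -mulr_suml -(bigA_distr_bigA (fun _ S => P S)).
by rewrite big1 ?mul1r.
Qed.

Definition avoid_prob (b : bidx N F) : R := \sum_S P S * (b \notin S)%:R.

(** A bit of the file of leader [k] is missing when [k] and all earlier leaders avoid it, which are
    [rank_in (leaders d) k] independent events. *)
Lemma expect_missing (d : 'I_K -> 'I_N) :
  expect (fun Ms => #|missing Ms d|%:R) =
  \sum_(k in leaders d) \sum_j avoid_prob (d k, j) ^+ rank_in (leaders d) k.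
Proof.
pose c (k k' : 'I_K) := (k' \in leaders d) && (k' <= k)%N.
pose g (k : 'I_K) (j : 'I_F) k' (S : cacheset N F) : R :=
  if c k k' then ((d k, j) \notin S)%:R else 1.
transitivity (expect (fun Ms =>
    \sum_(k in leaders d) \sum_j \prod_k' g k j k' (Ms k'))).
  apply: eq_bigr => Ms _; congr (_ * _).
  rewrite card_missing -sum1_card natr_sum big_mkcond pair_big_dep /=.
  rewrite [RHS]big_mkcond /=; apply: eq_bigr => -[k j] _ /=; rewrite inE /= andbT.
  case: (k \in leaders d) => //=; case: ifPn => [/forall_inP h|].
    rewrite big1 // => k' _; rewrite /g; case: ifP => // /andP[k'l k'k].
    by have := h k' k'l; rewrite k'k /= => ->.
  rewrite negb_forall => /existsP[k']; rewrite !negb_imply => /and4P[k'l k'k h _].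
  by rewrite (bigD1 k') //= /g /c k'l k'k h mul0r.
rewrite expect_sum; apply: eq_bigr => k _; rewrite expect_sum; apply: eq_bigr => j _.
rewrite expect_prod (bigID (c k)) /= [X in _ * X]big1 ?mulr1; last first.
  by move=> k' /negbTE ck'; rewrite -[RHS]P_sum1; apply: eq_bigr => S _; rewrite /g ck' mulr1.
rewrite /rank_in -prodr_const; apply: eq_big => [k'|k' ck']; first by rewrite inE.
by apply: eq_bigr => S _; rewrite /g ck'.
Qed.

Lemma avoid_prob_ge0 b : 0 <= avoid_prob b.
Proof. by apply: sumr_ge0 => S _; rewrite mulr_ge0. Qed.

(** After exchanging the sums: every cache of nonzero probability leaves out at least
    [N * F - M * F] bits. *)
Lemma sum_avoid_prob (M : R) : (0 < N)%N ->
  (forall S, P S != 0 -> #|S|%:R <= M * F%:R) ->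
  #|bidx N F|%:R * (1 - M / N%:R) <= \sum_b avoid_prob b.
Proof.
move=> N0 PM; have N0R : N%:R != 0 :> R by rewrite pnatr_eq0 -lt0n.
rewrite exchange_big /=.
rewrite card_prod !card_ord (_ : _ * _ = (N * F)%N%:R - M * F%:R); last first.
  by rewrite natrM; field.
rewrite -[leLHS]mul1r -[X in X * _ <= _]P_sum1 mulr_suml; apply: ler_sum => S _.
have [->|PS0] := eqVneq (P S) 0; first by rewrite mul0r big1 // => b _; rewrite mul0r.
rewrite -mulr_sumr ler_wpM2l // -natr_sum.
rewrite (_ : (\sum_b _)%N = #|~: S|); last first.
  by rewrite -sum1_card [RHS]big_mkcond /=; apply: eq_bigr => b _; rewrite inE; case: (_ \in _).
have /(congr1 (fun n => n%:R : R)) := cardsC S.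
rewrite natrD card_prod !card_ord => <-; have := PM S PS0; lra.
Qed.

End Expectation.

(** * The converse *)

Section MinimumRate.
Variables (R : realType) (N F K : nat) (P : {ffun cacheset N F -> R}).
Hypothesis F_gt0 : (0 < F)%N.
Implicit Types (d : 'I_K -> 'I_N) (Rt eps : R).

Let FR_gt0 : 0 < F%:R :> R. Proof. by rewrite ltr0n. Qed.

Lemma achievable_ge0 Rt eps d : achievable P Rt eps d -> 0 <= Rt.
Proof.
move=> [epsM [/(_ [ffun=> finset.set0]) [L [_ [_ [LR _]]]] _]].
by rewrite -(pmulr_lge0 _ FR_gt0) (le_trans _ LR).
Qed.

Lemma Rstar_eps_le Rt eps d : achievable P Rt eps d -> Rstar_eps P eps d <= Rt.
Proof. by move=> ach; apply: ge_inf => //; exists 0 => r /=; exact: achievable_ge0. Qed.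

Lemma le_Rstar_eps c eps d : 0 <= eps ->
  (forall Rt, achievable P Rt eps d -> c <= Rt) -> c <= Rstar_eps P eps d.
Proof.
(* The set of rates must be shown nonempty: delivery with all blocks padded to [F] bits has no
   errors, whatever the caches. *)
move=> eps0 cR; apply: lb_le_inf => //.
pose len := xmit_len (leaders d) (fun=> F).
exists ((\sum_A len A)%:R / F%:R), (fun=> 0); split=> [Ms|]; last first.
  by rewrite big1 // => Ms _; rewrite mulr0.
apply: (@achievable_delivery _ _ _ _ _ (leaders d) (fun=> F)) => [f S|x|].
- by rewrite -[X in (_ <= X)%N](card_ord F) max_card.
- by have [u [? ? _]] := leaders_rep d x; exists u.
- by rewrite divfK ?gt_eqF.
Qed.

Hypothesis P_ge0 : forall S, 0 <= P S.
Hypothesis P_sum1 : \sum_S P S = 1.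

Lemma Rstar_eps_cutset eps d : 0 <= eps ->
  expect P (fun Ms => #|missing Ms d|%:R) / F%:R - F%:R^-1 - 2 * K%:R * N%:R * eps
    <= Rstar_eps P eps d.
Proof.
move=> eps0; apply: le_Rstar_eps => // Rt [epsM [det Eeps]].
have missP (Ms : {ffun 'I_K -> cacheset N F}) : #|missing Ms d|%:R <=
    (Rt * F%:R + 1) + 2 * K%:R * (N * F)%N%:R * epsM Ms.
  (* As soon as there is a user, [epsM Ms] dominates an error probability and is nonnegative. *)
  apply: missing_le (det Ms) => K0; have [L [enc [dec [_ /(_ (Ordinal K0))]]]] := det Ms.
  by apply: le_trans; rewrite /err_prob divr_ge0.
have := expect_le P_ge0 missP.
rewrite expectD expectZ expect_cst // => h.
rewrite -(ler_pM2r FR_gt0) !mulrBl divfK ?gt_eqF // mulVf ?gt_eqF //.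
have : 2 * K%:R * (N * F)%N%:R * expect P epsM <= 2 * K%:R * (N * F)%N%:R * eps.
  by rewrite ler_wpM2l // !mulr_ge0.
by move: h; rewrite natrM; lra.
Qed.

End MinimumRate.

Lemma Ed_le (R : realType) (N K : nat) (f g : {ffun 'I_K -> 'I_N} -> R) :
  (forall d, f d <= g d) -> Ed f <= Ed g.
Proof. by move=> fg; rewrite ler_wpM2r ?invr_ge0 // ler_sum. Qed.

Lemma EdD (R : realType) (N K : nat) (f g : {ffun 'I_K -> 'I_N} -> R) :
  Ed (fun d => f d + g d) = Ed f + Ed g.
Proof. by rewrite /Ed big_split mulrDl. Qed.

Lemma EdZ (R : realType) (N K : nat) c (f : {ffun 'I_K -> 'I_N} -> R) :
  Ed (fun d => f d * c) = Ed f * c.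
Proof. by rewrite /Ed -mulr_suml mulrAC. Qed.

Lemma Ed_cst (R : realType) (N K : nat) (c : R) : (0 < N)%N ->
  Ed (fun _ : {ffun 'I_K -> 'I_N} => c) = c.
Proof.
move=> N0; rewrite /Ed sumr_const card_ffun !card_ord -[c *+ _]mulr_natr mulfK //.
by rewrite pnatr_eq0 -lt0n expn_gt0 N0.
Qed.

(** * Averaging over cyclic shifts of the demand *)

Section CyclicShift.
Variables (R : realType) (N' K : nat).
Let N := N'.+1.
Implicit Types (c : 'I_N) (d : {ffun 'I_K -> 'I_N}).

(** Addition is modulo [N]; the successor form of [N] provides the group structure. *)
Definition shift_demand c d : {ffun 'I_K -> 'I_N} := [ffun k => d k + c].

Lemma leaders_shift c d : leaders (shift_demand c d) = leaders d.
Proof.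
apply/setP => k; rewrite !inE; apply: eq_forallb => j.
by rewrite !ffunE (inj_eq (addIr c)).
Qed.

Lemma Ed_shift (f : {ffun 'I_K -> 'I_N} -> R) :
  Ed f = Ed (fun d => (\sum_c f (shift_demand c d)) / N%:R).
Proof.
rewrite EdZ /Ed mulrAC; congr (_ * _); rewrite exchange_big /=.
suff eqS c : \sum_d f (shift_demand c d) = \sum_d f d.
  under [in RHS]eq_bigr do rewrite eqS.
  by rewrite sumr_const card_ord -[X in _ = X / _]mulr_natr mulfK // pnatr_eq0.
rewrite [RHS](reindex (shift_demand c)) //.
exists (shift_demand (- c)) => d _; apply/ffunP => k; rewrite !ffunE ?addrK ?addrNK //.
Qed.

(** Shifts keep the leaders and their ranks, while the file of each leader runs through the whole
    library. Jensen then applies to all bits at once, separately for each leader. *)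
Lemma Ed_leaders_jensen (F : nat) (q : bidx N F -> R) (t : R) :
  (forall b, 0 <= q b) -> 0 <= t -> #|bidx N F|%:R * t <= \sum_b q b ->
  Ed (fun d => \sum_(i < Ne d) t ^+ i.+1) * F%:R <=
  Ed (fun d => \sum_(k in leaders d) \sum_j q (d k, j) ^+ rank_in (leaders d) k).
Proof.
move=> q0 t0 qt; rewrite [leRHS]Ed_shift -EdZ; apply: Ed_le => d.
under [X in _ <= X / _]eq_bigr do rewrite !leaders_shift.
rewrite exchange_big /= -card_leaders -(big_rank_in (fun i => t ^+ i)).
rewrite !mulr_suml; apply: ler_sum => k _.
rewrite ler_pdivlMr ?ltr0n // -mulrA [F%:R * _]mulrC -natrM mulrC.
have := exprn_jensen (rank_in (leaders d) k) q0 t0 qt.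
rewrite card_prod !card_ord => /le_trans; apply.
rewrite (eq_bigr (fun b => q (b.1, b.2) ^+ rank_in (leaders d) k)) => [|[]//].
rewrite -(pair_bigA _ (fun f j => q (f, j) ^+ rank_in (leaders d) k)) /=.
rewrite (reindex_inj (addrI (d k))) /=.
by apply: ler_sum => c _; apply: ler_sum => j _; rewrite ffunE.
Qed.

End CyclicShift.

Lemma Ed_Rstar_eps_ge (R : realType) (N F K : nat) (M eps : R)
    (P : {ffun cacheset N F -> R}) :
  (0 < N)%N -> (0 < F)%N -> M <= N%:R -> 0 <= eps -> prefetching M P ->
  Ed (fun d : {ffun 'I_K -> 'I_N} => \sum_(i < Ne d) (1 - M / N%:R) ^+ i.+1)
    - F%:R^-1 - 2 * K%:R * N%:R * eps
  <= Ed (fun d : {ffun 'I_K -> 'I_N} => Rstar_eps P eps d).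
Proof.
case: N P => // N' P N0 F0 MN eps0 [P0 [P1 PM]].
have FR : 0 < F%:R :> R by rewrite ltr0n.
apply: le_trans (Ed_le (fun d : {ffun 'I_K -> 'I_N'.+1} =>
  Rstar_eps_cutset F0 P0 P1 d eps0)).
rewrite !EdD !Ed_cst // EdZ !lerD2r ler_pdivlMr //.
apply: le_trans (@Ed_leaders_jensen _ _ _ _ (avoid_prob P) _ _ _ _) _.
- exact: avoid_prob_ge0.
- by rewrite subr_ge0 ler_pdivrMr ?ltr0n // mul1r.
- exact: sum_avoid_prob.
- by apply: Ed_le => d; rewrite expect_missing.
Qed.

(** * Weights and uniform draws *)

Lemma prod_set_weight (S : comNzRingType) (T : finType) (A : {set T}) (p q : S) :
  \prod_x (if x \in A then p else q) = p ^+ #|A| * q ^+ (#|T| - #|A|).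
Proof.
rewrite (bigID (mem A)) /=; congr (_ * _).
  by rewrite -prodr_const; apply: eq_bigr => x ->.
rewrite -(cardsC A) addKn -prodr_const.
by apply: eq_big => x; rewrite ?inE // => /negbTE ->.
Qed.

Section DeliveryRate.
Variables (T : finType) (U : {set T}).

(** Expand the product of the factors [p + q], with [p] replaced by 0 on [B]. *)
Lemma sum_disjoint_weight (S : comNzRingType) (p q : S) (B : {set T}) :
  \sum_(A : {set T} | [disjoint A & B]) p ^+ #|A| * q ^+ (#|T| - #|A|) =
  q ^+ #|B| * (p + q) ^+ (#|T| - #|B|).
Proof.
transitivity (\prod_x ((if x \in B then 0 else p) + q)).
  rewrite bigA_distr [RHS](bigID (fun A : {set T} => [disjoint A & B]%B)) /=.
  rewrite [X in _ = _ + X]big1 ?addr0 => [|A]; last first.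
    by case/pred0Pn => x /= /andP[xA xB]; rewrite (bigD1 x) //= xA xB mul0r.
  apply: eq_bigr => A AB; rewrite -prod_set_weight; apply: eq_bigr => x _.
  by case: ifP => // xA; rewrite (disjointFr AB xA).
by rewrite -prod_set_weight; apply: eq_bigr => x _; case: ifP; rewrite ?add0r.
Qed.

(** The factor [p] turns each summand into [1 - p] times the weight of [A] as a random set of
    density [p]. Such a set meets [U] with total weight [1 - (1 - p) ^+ #|U|], and a geometric sum
    remains. *)
Lemma delivery_rate_mul (S : comNzRingType) (p : S) :
  p * \sum_(A : {set T} | ~~ [disjoint A & U])
        p ^+ #|A|.-1 * (1 - p) ^+ (#|T| - #|A|.-1) =
  p * \sum_(i < #|U|) (1 - p) ^+ i.+1.
Proof.
have -> : p * \sum_(i < #|U|) (1 - p) ^+ i.+1 = (1 - p) * (1 - (1 - p) ^+ #|U|).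
  under eq_bigr do rewrite exprS.
  by rewrite -mulr_sumr mulrCA -[1 - _ ^+ _]opprB subrX1; ring.
have e : \sum_(A : {set T}) p ^+ #|A| * (1 - p) ^+ (#|T| - #|A|) = 1.
  have := sum_disjoint_weight p (1 - p) finset.set0.
  rewrite cards0 subn0 expr0 mul1r subrKC expr1n => e1; rewrite -[RHS]e1; apply: eq_bigl => A.
  by apply/esym/pred0P => x /=; rewrite !inE andbF.
have := sum_disjoint_weight p (1 - p) U; rewrite subrKC expr1n mulr1 => <-.
move: e; rewrite (bigID (fun A : {set T} => [disjoint A & U]%B)) /=.
move=> /(canRL (addKr _)) e; rewrite [RHS]addrC in e.
rewrite -e.
rewrite !mulr_sumr; apply: eq_bigr => A /pred0Pn[x /andP[xA _]].
have A0 : (0 < #|A|)%N by apply/card_gt0P; exists x.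
rewrite mulrA -exprS prednK // mulrCA -exprS -subSn ?max_card //.
by rewrite -subn1 subnBA // addn1.
Qed.

Lemma delivery_rate (R : realFieldType) (p : R) :
  \sum_(A : {set T} | ~~ [disjoint A & U])
     p ^+ #|A|.-1 * (1 - p) ^+ (#|T| - #|A|.-1) =
  \sum_(i < #|U|) (1 - p) ^+ i.+1.
Proof.
(* Cancelling [p] in the polynomial ring covers the case [p = 0]. *)
have X0 : 'X != 0 :> {poly R} by rewrite polyX_eq0.
have /(mulfI X0)/(congr1 (horner_eval p)) := delivery_rate_mul ('X : {poly R}).
rewrite !rmorph_sum /=; under eq_bigr do
  rewrite rmorphM !rmorphXn rmorphB rmorph1 /= /horner_eval hornerX.
by under [RHS]eq_bigr do rewrite rmorphXn rmorphB rmorph1 /= /horner_eval hornerX.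
Qed.

End DeliveryRate.

Section UniformDraw.
Variables (R : realFieldType) (T : finType) (a : nat).
Hypothesis a_le : (a <= #|T|)%N.

Definition unif_draw : {ffun {set T} -> R} :=
  [ffun S : {set T} => if #|S| == a then ('C(#|T|, a))%:R^-1 else 0].

Let bin_neq0 : ('C(#|T|, a))%:R != 0 :> R.
Proof. by rewrite pnatr_eq0 -lt0n bin_gt0. Qed.

Lemma unif_draw_ge0 S : 0 <= unif_draw S.
Proof. by rewrite ffunE; case: ifP => //; rewrite invr_ge0. Qed.

Lemma unif_draw_subset (B : {set T}) :
  \sum_S unif_draw S * (S \subset B)%:R = ('C(#|B|, a))%:R / ('C(#|T|, a))%:R.
Proof.
rewrite -cards_draws -sum1_card natr_sum mulr_suml [RHS]big_mkcond /=.
apply: eq_bigr => S _; rewrite inE ffunE.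
by case: (_ \subset _); case: (_ == a); rewrite ?mulr0 ?mul0r ?mul1r ?mulr1.
Qed.

Lemma unif_draw_sum1 : \sum_S unif_draw S = 1.
Proof.
have := unif_draw_subset [set: T]%SET; rewrite cardsT divff // => e; rewrite -[RHS]e.
by apply: eq_bigr => S _; rewrite finset.subsetT mulr1.
Qed.

Let p : R := a%:R / #|T|%:R.

Lemma unif_draw_notin b : \sum_S unif_draw S * (b \notin S)%:R = 1 - p.
Proof.
have T0 : (0 < #|T|)%N by apply/card_gt0P; exists b.
have T0R : #|T|%:R != 0 :> R by rewrite pnatr_eq0 -lt0n.
have e (S : {set T}) : (b \notin S) = (S \subset ~: [set b]%SET).
  by rewrite -finset.in_setC -finset.sub1set -finset.setCS finset.setCK.
under eq_bigr do rewrite e.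
rewrite unif_draw_subset cardsCs finset.setCK cards1 subn1.
apply: (mulIf bin_neq0); apply: (mulfI T0R).
rewrite divfK // -natrM mul_bin_down natrM natrB // /p; field.
exact: T0R.
Qed.

Lemma unif_draw_in b : \sum_S unif_draw S * (b \in S)%:R = p.
Proof.
apply: (addIr (1 - p)); rewrite subrKC -[RHS]unif_draw_sum1 -(unif_draw_notin b) -big_split.
by apply: eq_bigr => S _ /=; case: (b \in S); rewrite !(mulr0, mulr1, addr0, add0r).
Qed.

(** Without replacement, once [b] is avoided, [c] is avoided with probability at most [1 - p]. Both
    ratios of binomials come from [mul_bin_down]. *)
Lemma unif_draw_notin2 b c : b != c ->
  \sum_S unif_draw S * ((b \notin S)%:R * (c \notin S)%:R) <= (1 - p) ^+ 2.
Proof.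
move=> bc.
have T2 : (1 < #|T|)%N.
  by rewrite -[2%N](_ : #|[set b; c]%SET| = 2%N) ?max_card // cards2 bc.
have T0R : 0 < #|T|%:R :> R by rewrite ltr0n ltnW.
have T1R : 0 < #|T|.-1%:R :> R by rewrite ltr0n -ltnS prednK // ltnW.
have -> : \sum_S unif_draw S * ((b \notin S)%:R * (c \notin S)%:R) =
    \sum_S unif_draw S * (S \subset ~: [set b; c]%SET)%:R.
  apply: eq_bigr => S _; congr (_ * _); rewrite -natrM mulnb; congr (nat_of_bool _)%:R.
  by rewrite -finset.setCS finset.setCK finset.subUset !finset.sub1set !inE.
rewrite unif_draw_subset cardsCs finset.setCK cards2 bc.
have e1 := mul_bin_down #|T| a; have e2 := mul_bin_down #|T|.-1 a.
have {}e1 : #|T|%:R * ('C(#|T|.-1, a))%:R = (#|T|%:R - a%:R) * ('C(#|T|, a))%:R :> R.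
  by rewrite -natrB // -!natrM e1.
have e2' : #|T|.-1%:R * ('C(#|T| - 2, a))%:R
    <= #|T|.-1%:R * (1 - p) * ('C(#|T|.-1, a))%:R.
  rewrite subn2 -natrM e2 natrM ler_wpM2r //.
  rewrite -(ler_pM2r T0R) /p -mulrA mulrBl mul1r divfK ?gt_eqF //.
  rewrite -natrB // -!natrM ler_nat; nia.
rewrite ler_pdivrMr; last by rewrite lt0r bin_neq0 /=.
rewrite -(ler_pM2l T1R) (le_trans e2') // -mulrA ler_pM2l //.
rewrite expr2 -mulrA ler_wpM2l //.
  by rewrite subr_ge0 /p ler_pdivrMr // mul1r ler_nat.
rewrite -(ler_pM2l T0R) e1 /p le_eqVlt; apply/orP; left; apply/eqP; field.
by rewrite gt_eqF.
Qed.

(** By inclusion-exclusion, membership has the same covariance as avoidance. *)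
Lemma unif_draw_in2 b c : b != c ->
  \sum_S unif_draw S * ((b \in S)%:R * (c \in S)%:R) <= p ^+ 2.
Proof.
move=> bc; have := unif_draw_notin2 bc.
have -> : \sum_S unif_draw S * ((b \notin S)%:R * (c \notin S)%:R) =
   \sum_S unif_draw S * ((b \in S)%:R * (c \in S)%:R)
   + (\sum_S unif_draw S * (b \notin S)%:R - \sum_S unif_draw S * (c \in S)%:R).
  rewrite -sumrB -big_split; apply: eq_bigr => S _ /=; rewrite -mulrBr -mulrDr.
  by congr (_ * _); case: (b \in S); case: (c \in S); rewrite /=; ring.
rewrite unif_draw_notin unif_draw_in => h.
have := lerB h (lexx (1 - p - p)); rewrite addrK => /le_trans; apply.
by rewrite le_eqVlt; apply/orP; left; apply/eqP; ring.
Qed.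

End UniformDraw.

(** * Concentration *)

Section Concentration.
Variables (R : realType) (N F K a : nat).
Hypothesis a_le : (a <= #|bidx N F|)%N.

Let P : {ffun cacheset N F -> R} := unif_draw R (bidx N F) a.
Let p : R := a%:R / #|bidx N F|%:R.
Let P_ge0 : forall S, 0 <= P S := unif_draw_ge0 R a.
Let P_sum1 : \sum_S P S = 1 := unif_draw_sum1 R a_le.
Let p_ge0 : 0 <= p. Proof. by rewrite divr_ge0. Qed.
Let p_le1 : p <= 1.
Proof.
have [T0|T0] := posnP #|bidx N F|; first by rewrite /p T0 invr0 mulr0.
by rewrite /p ler_pdivrMr ?ltr0n // mul1r ler_nat.
Qed.

Definition pattern_prob (s : nat) : R := p ^+ s * (1 - p) ^+ (K - s).

Lemma pattern_prob_ge0 s : 0 <= pattern_prob s.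
Proof. by rewrite mulr_ge0 ?exprn_ge0 // subr_ge0. Qed.

Let hit (S : {set 'I_K}) (b : bidx N F) (Ms : {ffun 'I_K -> cacheset N F}) : R :=
  (cached_by Ms b == S)%:R.

(** The product form over users that [expect_prod] requires. *)
Let hitE S b Ms : hit S b Ms =
  \prod_k (if k \in S then (b \in Ms k)%:R else (b \notin Ms k)%:R).
Proof.
rewrite /hit; case: eqP => [<-|/eqP].
  by rewrite big1 // => k _; rewrite inE; case: (b \in Ms k).
move=> neq; have [k kP] : exists k, (k \in S) != (b \in Ms k).
  apply/existsP; apply: contraNT neq; rewrite negb_exists => /forallP h.
  by apply/eqP/setP => k; rewrite inE; apply/esym/eqP/negPn/h.
by rewrite (bigD1 k) //=; move: kP; do 2!case: (_ \in _) => //; rewrite mul0r.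
Qed.

Let prod_pattern (S : {set 'I_K}) : \prod_k (if k \in S then p else 1 - p) = pattern_prob #|S|.
Proof. by rewrite prod_set_weight card_ord. Qed.

Lemma expect_hit S b : expect P (hit S b) = pattern_prob #|S|.
Proof.
transitivity (expect P (fun Ms =>
    \prod_k (if k \in S then (b \in Ms k)%:R else (b \notin Ms k)%:R))).
  by apply: eq_bigr => Ms _; rewrite hitE.
rewrite (expect_prod P (fun k (M : cacheset N F) =>
  if k \in S then (b \in M)%:R else (b \notin M)%:R)) -prod_pattern.
apply: eq_bigr => k _; case: ifP => _; first exact: unif_draw_in.
exact: unif_draw_notin.
Qed.

Lemma expect_hit2 S b c : b != c ->
  expect P (fun Ms => hit S b Ms * hit S c Ms) <= pattern_prob #|S| ^+ 2.
Proof.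
move=> bc; pose g k (M : cacheset N F) : R :=
  if k \in S then (b \in M)%:R * (c \in M)%:R else (b \notin M)%:R * (c \notin M)%:R.
have -> : expect P (fun Ms => hit S b Ms * hit S c Ms) =
    expect P (fun Ms => \prod_k g k (Ms k)).
  apply: eq_bigr => Ms _; rewrite !hitE -big_split; congr (_ * _).
  by apply: eq_bigr => k _; rewrite /g; case: ifP.
rewrite expect_prod -prod_pattern -prodrXl; apply: ler_prod => k _.
rewrite /g; case: ifP => _; rewrite ?unif_draw_in2 ?unif_draw_notin2 // andbT;
  by apply: sumr_ge0 => M _; rewrite mulr_ge0 // mulr_ge0.
Qed.

Lemma card_blockE (Ms : {ffun 'I_K -> cacheset N F}) f (S : {set 'I_K}) :
  #|block Ms f S|%:R = \sum_j hit S (f, j) Ms.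
Proof.
rewrite -sum1_card natr_sum big_mkcond /=; apply: eq_bigr => j _.
by rewrite /hit inE; case: eqP.
Qed.

(** In the second moment the [F] diagonal terms are at most 1 and the others at most [w ^+ 2], so
    the squared mean cancels up to [F]. *)
Lemma variance_block f (S : {set 'I_K}) :
  expect P (fun Ms : {ffun 'I_K -> cacheset N F} =>
    (#|block Ms f S|%:R - F%:R * pattern_prob #|S|) ^+ 2) <= F%:R.
Proof.
set w := pattern_prob _; pose h j Ms := hit S (f, j) Ms.
have w1 : w <= 1.
  by rewrite mulr_ile1 ?exprn_ge0 ?exprn_ile1 ?subr_ge0 // gerBl.
have -> : expect P (fun Ms : {ffun 'I_K -> cacheset N F} =>
    (#|block Ms f S|%:R - F%:R * w) ^+ 2) =
  expect P (fun Ms => \sum_j \sum_j' h j Ms * h j' Ms)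
  + (- (2 * F%:R * w) * expect P (fun Ms => \sum_j h j Ms) + (F%:R * w) ^+ 2).
  rewrite -expectZ -[X in _ + (_ + X)](expect_cst K P_sum1) -!expectD.
  apply: eq_bigr => Ms _; congr (_ * _); rewrite card_blockE.
  under [X in _ = X + _]eq_bigr do rewrite -mulr_sumr.
  by rewrite -mulr_suml; ring.
rewrite !expect_sum [X in _ * X](eq_bigr (fun=> w)) => [|j _]; last exact: expect_hit.
rewrite sumr_const card_ord -[w *+ F]mulr_natl.
have : \sum_j expect P (fun Ms => \sum_j' h j Ms * h j' Ms) <= F%:R * (1 + F%:R * w ^+ 2).
  rewrite -[X in _ <= X%:R * _](card_ord F) mulr_natl -sumr_const; apply: ler_sum => j _.
  rewrite expect_sum (bigD1 j) //= lerD //.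
    rewrite -[leRHS](expect_cst K P_sum1); apply: expect_le => // Ms.
    by rewrite /h /hit -natrM mulnb lern1 leq_b1.
  rewrite -[X in _ <= X%:R * _](card_ord F) mulr_natl -sumr_const.
  (* The constant sum has one more term, at [j] itself, which is nonnegative. *)
  rewrite [leRHS](bigD1 j) //= -[leLHS]add0r lerD ?sqr_ge0 //.
  apply: ler_sum => j' jj'; apply: expect_hit2.
  by apply: contraNneq jj' => -[->].
by lra.
Qed.

(** One-sided, since only blocks that are too long spoil the delivery. *)
Definition typical (delta : R) (Ms : {ffun 'I_K -> cacheset N F}) : bool :=
  [forall f, [forall S : {set 'I_K},
     #|block Ms f S|%:R <= F%:R * (pattern_prob #|S| + delta)]].

(** Chebyshev with a union bound over the [N * 2 ^ K] pairs of a file and a set of users. *)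
Lemma expect_atypical (delta : R) : (0 < F)%N -> 0 < delta ->
  expect P (fun Ms => (~~ typical delta Ms)%:R)
    <= (N * 2 ^ K)%N%:R / (delta ^+ 2 * F%:R).
Proof.
move=> F0 d0; have FR : 0 < F%:R :> R by rewrite ltr0n.
have dF2 : 0 < (delta * F%:R) ^+ 2 by rewrite exprn_gt0 // mulr_gt0.
pose dev f (S : {set 'I_K}) (Ms : {ffun 'I_K -> cacheset N F}) :=
  (#|block Ms f S|%:R - F%:R * pattern_prob #|S|) ^+ 2.
apply: (@le_trans _ _ (expect P (fun Ms =>
    (delta * F%:R) ^- 2 * \sum_f \sum_S dev f S Ms))).
  apply: expect_le => // Ms.
  have dev0 f S : 0 <= dev f S Ms by rewrite sqr_ge0.
  have S0 f : 0 <= \sum_S dev f S Ms by apply: sumr_ge0.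
  have [|] := boolP (typical delta Ms).
    by move=> _; rewrite mulr_ge0 ?invr_ge0 ?exprn_ge0 ?sumr_ge0 ?mulr_ge0 // ltW.
  rewrite negb_forall => /existsP[f]; rewrite negb_forall => /existsP[S].
  rewrite -ltNge => big.
  rewrite mulrC ler_pdivlMr // mul1r (bigD1 f) //= (bigD1 S) //= -addrA.
  rewrite (@le_trans _ _ (dev f S Ms)) ?lerDl ?addr_ge0 ?sumr_ge0 //.
  by rewrite ler_sqr ?nnegrE; nra.
rewrite expectZ expect_sum mulrC ler_pdivrMr //.
apply: (@le_trans _ _ (\sum_(f < N) \sum_(S : {set 'I_K}) F%:R)).
  by apply: ler_sum => f _; rewrite expect_sum; apply: ler_sum => S _; exact: variance_block.
have cS : #|{: {set 'I_K}}| = (2 ^ K)%N.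
  by rewrite -cardsT -powersetT card_powerset cardsT card_ord.
rewrite !sumr_const card_ord cS -mulrnA mulnC -[X in X <= _]mulr_natl.
rewrite le_eqVlt; apply/orP; left; apply/eqP; field.
by rewrite !gt_eqF.
Qed.

End Concentration.

(** * Achievability and the limit *)

Lemma typical_delivery (R : realType) (N F K a : nat) (delta : R)
    (Ms : {ffun 'I_K -> cacheset N F}) (d : 'I_K -> 'I_N) :
  (a <= #|bidx N F|)%N -> 0 <= delta -> typical a delta Ms ->
  achievable_det (\sum_(i < #|leaders d|) (1 - a%:R / #|bidx N F|%:R) ^+ i.+1
                  + 2 ^+ K * delta) 0 Ms d.
Proof.
move=> a_le d0 typ; pose w s : R := F%:R * (pattern_prob R N F K a s + delta).
have w0 s : 0 <= w s by rewrite mulr_ge0 // addr_ge0 // pattern_prob_ge0.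
(* Block sizes are integers, so truncating the typical bound still covers them. *)
apply: (@achievable_delivery _ _ _ _ _ (leaders d) (fun s => Num.truncn (w s))).
- by move=> f S; rewrite truncn_ge_nat //; move/forallP/(_ f)/forallP/(_ S): typ.
- by move=> x; have [u [? ? _]] := leaders_rep d x; exists u.
rewrite natr_sum -delivery_rate card_ord mulrC mulrDr.
have -> : F%:R * (2 ^+ K * delta) = \sum_(A : {set 'I_K}) F%:R * delta.
  have cS : #|{: {set 'I_K}}| = (2 ^ K)%N.
    by rewrite -cardsT -powersetT card_powerset cardsT card_ord.
  by rewrite sumr_const cS -[RHS]mulr_natl natrX; ring.
rewrite mulr_sumr [X in _ <= X + _]big_mkcond -big_split /=.
apply: ler_sum => A _; rewrite /xmit_len; case: ifP => _ /=.
  by rewrite add0r mulr_ge0.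
by rewrite -mulrDr truncn_le.
Qed.

Section Achievability.
Variables (R : realType) (N : nat) (M : R).
Hypotheses (N_gt0 : (0 < N)%N) (M_ge0 : 0 <= M) (M_le : M <= N%:R).

Definition unif_scheme (F : nat) : {ffun cacheset N F -> R} :=
  unif_draw R (bidx N F) (Num.truncn (M * F%:R)).

Let card_bidx F : #|bidx N F| = (N * F)%N.
Proof. by rewrite card_prod !card_ord. Qed.

Let size_le F : (Num.truncn (M * F%:R))%:R <= M * F%:R.
Proof. by rewrite truncn_le mulr_ge0. Qed.

Let size_bidx F : (Num.truncn (M * F%:R) <= #|bidx N F|)%N.
Proof.
by rewrite -(ler_nat R) card_bidx natrM (le_trans (size_le F)) // ler_wpM2r.
Qed.

Lemma unif_scheme_dec : dec_scheme M unif_scheme.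
Proof.
move=> F; split; [exact: unif_draw_ge0|split; first exact: unif_draw_sum1].
move=> S; rewrite ffunE; case: ifP => [/eqP -> _|_]; first exact: size_le.
by rewrite eqxx.
Qed.

Lemma Rstar_unif_scheme (F K : nat) (eps delta : R) (d : {ffun 'I_K -> 'I_N}) :
  (0 < F)%N -> 0 < delta -> (N * 2 ^ K)%N%:R / (delta ^+ 2 * F%:R) <= eps ->
  Rstar_eps (unif_scheme F) eps d <=
  \sum_(i < Ne d) (1 - M / N%:R) ^+ i.+1 + ((K ^ 2)%N%:R / F%:R + 2 ^+ K * delta).
Proof.
move=> F0 d0 epsP; set a := Num.truncn (M * F%:R).
have FR : 0 < F%:R :> R by rewrite ltr0n.
have NR : 0 < N%:R :> R by rewrite ltr0n.
set t : R := 1 - a%:R / #|bidx N F|%:R; set Q : R := 1 - M / N%:R.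
have NF0 : 0 < #|bidx N F|%:R :> R by rewrite card_bidx natrM mulr_gt0.
have t0 : 0 <= t by rewrite subr_ge0 ler_pdivrMr // mul1r ler_nat size_bidx.
have t1 : t <= 1 by rewrite gerBl divr_ge0.
have Q0 : 0 <= Q by rewrite subr_ge0 ler_pdivrMr // mul1r.
have Q1 : Q <= 1 by rewrite gerBl divr_ge0.
have Qt : Q <= t.
  rewrite lerD2l lerN2 ler_pdivrMr // card_bidx natrM mulrA divfK ?gt_eqF //.
  exact: size_le.
(* Truncating [M * F%:R] loses less than one bit out of [N * F]. *)
have tQ : t - Q <= F%:R^-1.
  rewrite -(ler_pM2r NF0) mulrBl /t /Q !mulrBl divfK ?gt_eqF // card_bidx natrM.
  have -> : M / N%:R * (N%:R * F%:R) = M * F%:R by field; rewrite gt_eqF.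
  have -> : F%:R^-1 * (N%:R * F%:R) = N%:R :> R by field; rewrite gt_eqF.
  have := truncnS_gt (M * F%:R); rewrite -natr1 -/a.
  have : 1 <= N%:R :> R by rewrite ler1n.
  lra.
apply: (@le_trans _ _ (\sum_(i < Ne d) t ^+ i.+1 + 2 ^+ K * delta)); last first.
  rewrite addrA lerD2r.
  (* By the tangent at [t], each of the at most [K] powers changes by at most [K%:R / F%:R]. *)
  apply: (@le_trans _ _ (\sum_(i < Ne d) (Q ^+ i.+1 + K%:R / F%:R))).
    apply: ler_sum => i _.
    have NeK : (i < K)%N.
      apply: leq_trans (ltn_ord i) _; rewrite -card_leaders.
      by rewrite -[X in (_ <= X)%N](card_ord K) max_card.
    have h := exprn_tangent i Q0 t0.
    have ti : t ^+ i <= 1 by rewrite exprn_ile1.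
    have ti0 : 0 <= t ^+ i by rewrite exprn_ge0.
    have iK : i.+1%:R <= K%:R :> R by rewrite ler_nat.
    have : i.+1%:R * t ^+ i * (t - Q) <= K%:R / F%:R.
      rewrite ler_pM ?subr_ge0 // ?mulr_ge0 //.
      by rewrite -[leRHS]mulr1 ler_pM.
    lra.
  rewrite big_split lerD2l sumr_const card_ord -[X in X <= _]mulr_natl mulrA.
  rewrite ler_pM2r ?invr_gt0 // -natrM ler_nat -mulnn leq_mul2r -card_leaders.
  by rewrite -[X in (_ <= X)%N](card_ord K) max_card orbT.
apply: Rstar_eps_le => //.
(* Typical caches are served without error; for the others nothing is sent and the error is bounded
   by 1. *)
exists (fun Ms => (~~ typical a delta Ms)%:R); split=> [Ms|]; last first.
  exact: le_trans (expect_atypical _ _ F0 d0) epsP.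
have [typ|_] := boolP (typical a delta Ms).
  by rewrite -card_leaders; exact: (typical_delivery _ (size_bidx F) (ltW d0) typ).
exists 0%N, (fun=> [ffun=> false]), (fun _ _ _ => [ffun=> false]); split=> [|k].
  apply: mulr_ge0 => //; apply: addr_ge0.
    by apply: sumr_ge0 => i _; rewrite exprn_ge0.
  by rewrite mulr_ge0 ?exprn_ge0 // ltW.
have lib0 : 0 < #|{: library N F}|%:R :> R.
  by rewrite ltr0n; apply/card_gt0P; exists [ffun=> false].
by rewrite /err_prob ler_pdivrMr // mul1r ler_nat max_card.
Qed.

End Achievability.

(** * Eventual bounds and the passage to the limit *)

Section LimitSuperior.
Variables (R : realType) (u : (\bar R)^nat) (c : \bar R) (n0 : nat).
Local Open Scope ereal_scope.

Lemma limn_esup_le_eventually : (forall n, (n0 <= n)%N -> u n <= c) -> limn_esup u <= c.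
Proof.
move=> uc; apply: (@le_trans _ _ (ereal_sup (u @` [set n | (n0 <= n)%N]))).
  by apply: ereal_inf_lbound; exists [set n | (n0 <= n)%N] => //; exists n0.
by apply: ge_ereal_sup => _ [n /= ? <-]; exact: uc.
Qed.

Lemma le_limn_esup_eventually : (forall n, (n0 <= n)%N -> c <= u n) -> c <= limn_esup u.
Proof.
move=> uc; apply: le_ereal_inf_tmp => _ [A [m _ mA] <-].
apply: (le_trans (uc (maxn n0 m) (leq_maxl _ _))); apply: ereal_sup_ubound.
by exists (maxn n0 m) => //; apply: mA => /=; exact: leq_maxr.
Qed.

End LimitSuperior.

Lemma divr_nat_le_eventually (R : realType) (x e : R) : 0 < e ->
  exists2 n0, (0 < n0)%N & forall n, (n0 <= n)%N -> x / n%:R <= e.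
Proof.
move=> e0; exists (Num.truncn (`|x| / e)).+1 => // n ln.
have n0 : 0 < n%:R :> R by rewrite ltr0n (leq_trans _ ln).
rewrite ler_pdivrMr // (le_trans (ler_norm x)) // mulrC -ler_pdivrMr //.
by rewrite (le_trans (ltW (truncnS_gt _))) // ler_nat.
Qed.

Lemma region_powers (R : realType) (N : nat) (M : R) :
  (0 < N)%N -> 0 <= M -> M <= N%:R ->
  region N M = [set Rs | forall K : nat,
    Ed (fun d : {ffun 'I_K -> 'I_N} => \sum_(i < Ne d) (1 - M / N%:R) ^+ i.+1) <= Rs K].
Proof.
move=> N0 M0 MN; apply/seteqP; split=> Rs /=.
  move=> [PF [PFdec RsP]] K; apply/ler_addgt0Pr => e e0.
  have e2 : 0 < e / 2 by rewrite divr_gt0.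
  (* This keeps the error term of the converse below [e / 2]; the [+ 1] makes the denominator
     positive also for [K = 0]. *)
  pose eps := e / 2 / (2 * K%:R * N%:R + 1).
  have D0 : 0 < 2 * K%:R * N%:R + 1 :> R by rewrite ltr_wpDl // !mulr_ge0.
  have eps0 : 0 < eps by rewrite divr_gt0.
  have epsP : 2 * K%:R * N%:R * eps <= e / 2.
    by rewrite /eps mulrCA ger_pMr // ler_pdivrMr // mul1r lerDl.
  have [n0 n00 n0P] := divr_nat_le_eventually 1 e2.
  rewrite -lerBlDr -lee_fin; apply: le_trans (RsP K).
  apply: le_trans (ereal_sup_ubound _); last by exists eps.
  apply: (le_limn_esup_eventually (n0 := n0)) => F nF; rewrite lee_fin.
  have F0 := leq_trans n00 nF.
  apply: le_trans (Ed_Rstar_eps_ge K N0 F0 MN (ltW eps0) (PFdec F)).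
  by have := n0P F nF; rewrite mul1r; lra.
move=> RsP; exists (unif_scheme N M); split; first exact: unif_scheme_dec.
move=> K; apply: ge_ereal_sup => _ [eps /= eps0 <-].
apply: (le_trans _ (_ : (Ed (fun d : {ffun 'I_K -> 'I_N} =>
  \sum_(i < Ne d) (1 - M / N%:R) ^+ i.+1))%:E <= _)%E); last by rewrite lee_fin RsP.
apply/lee_addgt0Pr => e e0; rewrite -EFinD.
have e2 : 0 < e / 2 by rewrite divr_gt0.
have K2 : 0 < 2 ^+ K :> R by rewrite exprn_gt0.
(* The slack over all [2 ^ K] sets then amounts to [e / 2]; [n1] handles the truncation error and
   [n2] the atypical caches. *)
pose delta := e / 2 / 2 ^+ K; have delta0 : 0 < delta by rewrite divr_gt0.
have [n1 n10 n1P] := divr_nat_le_eventually (K ^ 2)%N%:R e2.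
have [n2 _ n2P] := divr_nat_le_eventually ((N * 2 ^ K)%N%:R / delta ^+ 2) eps0.
apply: (limn_esup_le_eventually (n0 := maxn n1 n2)) => F.
rewrite geq_max => /andP[nF1 nF2]; rewrite lee_fin -[e in leRHS](Ed_cst K _ N0) -EdD.
apply: Ed_le => d; have F0 := leq_trans n10 nF1.
apply: le_trans (Rstar_unif_scheme N0 M0 MN d F0 delta0 _) _.
  by rewrite invfM mulrA n2P.
rewrite lerD2l /delta [2 ^+ K * _]mulrC divfK ?gt_eqF //; have := n1P F nF1; lra.
Qed.

Theorem theorem2 (R : realType) (N : nat) (M : R) :
  (0 < N)%N -> 0 <= M -> M <= N%:R ->
  (0 < M ->
     region N M =
     [set Rs | forall K : nat,
        Ed (fun d : {ffun 'I_K -> 'I_N} =>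
              (N%:R - M) / M * (1 - ((N%:R - M) / N%:R) ^+ Ne d)) <= Rs K]) /\
  (M = 0 ->
     region N M =
     [set Rs | forall K : nat,
        Ed (fun d : {ffun 'I_K -> 'I_N} => (Ne d)%:R) <= Rs K]).
Proof.
move=> N0 M0 MN; have NR : N%:R != 0 :> R by rewrite pnatr_eq0 -lt0n.
have eqEd (f g : forall K, {ffun 'I_K -> 'I_N} -> R) : (forall K d, f K d = g K d) ->
    [set Rs : nat -> R | forall K, Ed (f K) <= Rs K] =
    [set Rs | forall K, Ed (g K) <= Rs K].
  move=> fg; apply/seteqP; split=> Rs /= h K; apply: le_trans (h K);
    by apply: Ed_le => d; rewrite fg.
rewrite region_powers //; split=> [Mgt0|->]; apply: eqEd => K d.
  (* Geometric sum with ratio [q = (N%:R - M) / N%:R], for which [q / (1 - q)] is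
     [(N%:R - M) / M]. *)
  have -> : 1 - M / N%:R = (N%:R - M) / N%:R by rewrite mulrBl divff.
  under eq_bigr do rewrite exprS.
  rewrite -mulr_sumr -[1 - _ ^+ _]opprB subrX1; field.
  by rewrite NR gt_eqF.
under eq_bigr do rewrite mul0r subr0 expr1n.
by rewrite sumr_const card_ord.
Qed.
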